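(* Let $A\in\mathbb{R}^{n,n}$, $q\in\mathbb{R}$ and $r>0$. Then $A$ is $\Omega_D(-q,r)$-stable if and only if $A=(J-R)Q$ for some $J,R,Q\in\mathbb{R}^{n,n}$ such that $J^T=-J$, $R$ is symmetric, $Q\succ 0$ and $$\begin{bmatrix} rQ^{-1} & -qQ^{-1}\\ -qQ^{-1} & rQ^{-1}\end{bmatrix}\succ\begin{bmatrix}0 & J-R\\ (J-R)^T & 0\end{bmatrix}.$$
   Context: $\mathbb{R}^{n,n}$ denotes the real $n\times n$ matrices, $n\ge 1$. For a real matrix $X$, $X\succ 0$ means that $X$ is symmetric and positive definite, and $X\succ Y$ means $X-Y\succ 0$. The disk region is $$\Omega_D(-q,r)=\{z\in\mathbb{C} : |z+q|<r\}.$$ For a set $\Omega\subseteq\mathbb{C}$, a matrix $A\in\mathbb{R}^{n,n}$ is called $\Omega$-stable if all its eigenvalues (in $\mathbb{C}$) lie in $\Omega$. *)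

(* Defs.v *)
From mathcomp Require Import all_boot all_order all_algebra.
From mathcomp Require Import complex.
From mathcomp Require Import classical_sets reals.

Set Implicit Arguments.
Unset Strict Implicit.
Unset Printing Implicit Defensive.

Import Order.TTheory GRing.Theory Num.Theory.

Local Open Scope ring_scope.
Local Open Scope complex_scope.
Local Open Scope classical_set_scope.

Definition posdef (R : realType) (n : nat) (X : 'M[R]_n) : Prop :=
  X^T = X /\ forall v : 'cV[R]_n, v != 0 -> 0 < (v^T *m X *m v) 0 0.

Definition pd_gt (R : realType) (n : nat) (X Y : 'M[R]_n) : Prop :=
  posdef (X - Y).

(* The strict order on [R[i]] forces both sides to have the same imaginary
   part; here both sides are real, so this is the order of [R]. *)
Definition Omega_disk (R : realType) (c r : R) : set R[i] :=
  [set z : R[i] | `|z - c%:C| < r%:C].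

(* [eigenvalue] is stated for row vectors, which gives the same eigenvalues as
   column vectors; the matrix is complexified so that the whole complex
   spectrum is constrained. *)
Definition Omega_stable (R : realType) (n : nat) (Omega : set R[i])
    (A : 'M[R]_n) : Prop :=
  forall z : R[i], eigenvalue (map_mx (real_complex R) A) z -> Omega z.

(* Main.v *)
Require Import Defs.
From mathcomp Require Import all_boot all_order all_algebra.
From mathcomp Require Import complex.
From mathcomp Require Import classical_sets reals.
From mathcomp Require Import ring lra spectral.

Set Implicit Arguments.
Unset Strict Implicit.
Unset Printing Implicit Defensive.

Import Order.TTheory GRing.Theory Num.Theory.

Local Open Scope ring_scope.

(** Put [B = A + q I] and [P = Q^-1].  Every real matrix is [J - S] with [J]
    skew-symmetric and [S] symmetric, so the choice of [J] and [S] carries no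
    constraint: [A = (J - S) Q] only says that [J - S = A P].  The block
    inequality then says that the matrix with diagonal blocks [r P] and
    off-diagonal blocks [- B P] and [- P B^T] is positive definite, and
    completing the square ([posdef_block]) turns this into the Stein inequality
    [r^2 P - B P B^T > 0].  On the other side, the disk condition on [A] says
    that every eigenvalue [z] of [B] satisfies [|z|^2 < r^2]
    ([disk_stable_sqnorm]).  What is left is Stein's theorem: the spectrum of
    [B] lies in the open disk of radius [r] around [0] iff some positive
    definite [P] satisfies the Stein inequality.

    From the inequality to the spectrum ([spectrum_of_stein]): a left
    eigenvector [x + i y] of [B] with eigenvalue [z] makes the sum of the values
    of [B P B^T] at [x] and [y] equal to [|z|^2] times that of [P], whence
    [|z|^2 < r^2].

    From the spectrum to the inequality ([stein_of_spectrum]): triangularise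
    [B W = W T] over the complex numbers.  For the lower triangular [T], whose
    diagonal lies in the disk, a diagonal solution [D] of the Stein inequality
    exists: build it one coordinate at a time, giving each new coordinate a
    weight small enough to absorb its coupling with the others
    ([triangular_weights]).  Then [W D W^*] is a Hermitian solution for [B];
    since [B] is real, its real part, which takes the same values on real
    vectors, is a real solution.  It can be written directly from the real and
    imaginary parts of [W] ([realform]), so that no Hermitian form is needed.
    All estimates are made on the real-valued squared modulus. *)

(** * Squared moduli and triangular systems *)

Section SquaredModulus.
Context {R : realType}.
Local Open Scope complex_scope.

Definition sqnorm (z : R[i]) : R := complex.Re z ^+ 2 + complex.Im z ^+ 2.

Lemma sqnorm_ge0 z : 0 <= sqnorm z.
Proof. by rewrite addr_ge0 ?sqr_ge0. Qed.

Lemma sqnorm_eq0 z : sqnorm z = 0 -> z = 0.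
Proof.
case: z => a b /eqP; rewrite /sqnorm /= paddr_eq0 ?sqr_ge0 // !sqrf_eq0.
by case/andP => /eqP -> /eqP ->.
Qed.

Lemma sqnormM z w : sqnorm (z * w) = sqnorm z * sqnorm w.
Proof. by case: z w => [a b] [c d]; rewrite /sqnorm /=; ring. Qed.

Lemma normc_lt (z : R[i]) (r : R) : 0 < r ->
  (`|z| < r%:C) = (sqnorm z < r ^+ 2).
Proof.
move=> r0; rewrite normc_def ltcR -/(sqnorm z) -{1}(gtr0_norm r0) -sqrtr_sqr.
by rewrite ltr_sqrt // exprn_gt0.
Qed.

(** The defect is the squared modulus of [t z - w], divided by [t]. *)
Lemma sqnormD_young (t : R) z w : 0 < t ->
  sqnorm (z + w) <= (1 + t) * sqnorm z + (1 + t^-1) * sqnorm w.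
Proof.
move=> t0; case: z w => [a b] [c d]; rewrite /sqnorm /= -subr_ge0.
have tn : t != 0 by rewrite gt_eqF.
rewrite (_ : _ - _ = t^-1 * ((t * a - c) ^+ 2 + (t * b - d) ^+ 2)).
  by rewrite mulr_ge0 ?addr_ge0 ?sqr_ge0 // invr_ge0 ltW.
by field.
Qed.

(** The slack between [|l|^2] and [s] pays for the cross term in
    [|x l + b|^2], at the price of a possibly large factor on [|b|^2]. *)
Lemma sqnorm_contraction (s : R) (l : R[i]) : sqnorm l < s ->
  exists d K : R, [/\ 0 < d, 0 < K &
    forall x b, sqnorm (x * l + b) <= (s - d) * sqnorm x + K * sqnorm b].
Proof.
move=> ls; have l0 := sqnorm_ge0 l; have s0 : 0 < s := le_lt_trans l0 ls.
set d := (s - sqnorm l) / 2; have d0 : 0 < d by rewrite /d; lra.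
(* With this parameter, (1 + d / s) |l|^2 <= |l|^2 + d = s - d. *)
have t0 : 0 < d / s by rewrite divr_gt0.
exists d, (1 + (d / s)^-1); split => // [|x b].
  by rewrite ltr_wpDl // invr_gt0.
apply: le_trans (sqnormD_young _ _ t0) _; rewrite lerD2r sqnormM.
have x0 := sqnorm_ge0 x.
rewrite mulrC -mulrA mulrC ler_wpM2r //.
have : d / s * sqnorm l <= d.
  by rewrite mulrAC ler_pdivrMr // ler_wpM2l // ltW.
rewrite /d; nra.
Qed.

Lemma sqnorm_sum_le n (c : 'I_n -> R[i]) : exists2 M : R, 0 <= M &
  forall v : 'I_n -> R[i],
    sqnorm (\sum_i v i * c i) <= M * \sum_i sqnorm (v i).
Proof.
elim: n c => [|n IHn] c.
  exists 0 => // v; rewrite !big_ord0 /sqnorm /=; lra.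
have [M M0 MP] := IHn (fun i => c (lift ord0 i)).
have c0 := sqnorm_ge0 (c ord0).
exists (2 * sqnorm (c ord0) + 2 * M); first by lra.
move=> v; rewrite !big_ord_recl.
have /= := sqnormD_young (v ord0 * c ord0)
  (\sum_i v (lift ord0 i) * c (lift ord0 i)) ltr01.
have := MP (fun i => v (lift ord0 i)); rewrite sqnormM invr1.
have := sqnorm_ge0 (v ord0).
have : 0 <= \sum_i sqnorm (v (lift ord0 i)).
  by apply: sumr_ge0 => i _; apply: sqnorm_ge0.
move: (sqnorm (v ord0)) (sqnorm (c ord0)) c0 (\sum_i sqnorm _) => x y c0 N.
move=> N0 x0 tail young; have := mulr_ge0 c0 N0; have := mulr_ge0 M0 x0.
lra.
Qed.

(** The weights [h] give a diagonal solution of the Stein inequality for a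
    lower triangular matrix.  The induction needs the uniform margin [e]: the
    first column of [T] couples the new coordinate to all the others, and this
    coupling, scaled by the new weight, has to fit into the margin left by the
    other coordinates. *)
Lemma triangular_weights (s : R) n (T : 'I_n -> 'I_n -> R[i]) :
  (forall i j : 'I_n, (i < j)%N -> T i j = 0) ->
  (forall i, sqnorm (T i i) < s) ->
  exists (h : 'I_n -> R) (e : R),
    [/\ 0 < e, forall j, 0 < h j & forall v : 'I_n -> R[i],
      \sum_j h j * sqnorm (\sum_i v i * T i j) + e * \sum_j sqnorm (v j)
      <= s * \sum_j h j * sqnorm (v j)].
Proof.
elim: n T => [|n IHn] T Ttrig Tdiag.
  exists (fun=> 1), 1; split => // v; rewrite !big_ord0; lra.
have [||h [e [e0 h0 hP]]] := IHn (fun i j => T (lift ord0 i) (lift ord0 j)).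
- by move=> i j ij; apply: Ttrig; rewrite /= /bump /= !add1n ltnS.
- by move=> i; apply: Tdiag.
have [d [K [d0 K0 KP]]] := sqnorm_contraction (Tdiag ord0).
have [M M0 MP] := sqnorm_sum_le (fun i => T (lift ord0 i) ord0).
(* The coupling costs k K M times the squared norm of the old coordinates; this
   weight keeps it below half of their margin e. *)
set k := e / (2 * (K * M + 1)).
have KM : 0 <= K * M by rewrite mulr_ge0 // ltW.
have k0 : 0 < k by rewrite divr_gt0 //; lra.
have kKM : k * K * M <= e / 2.
  have : k * (K * M + 1) = e / 2 by rewrite /k; field; lra.
  by nra.
exists (fun j => if unlift ord0 j is Some j' then h j' else k).
exists (Num.min (k * d) (e / 2)); split.
- by rewrite lt_min mulr_gt0 //= divr_gt0.
- by move=> j; case: unliftP.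
move=> v; rewrite !big_ord_recl unlift_none.
rewrite (eq_bigr (fun j => h j *
  sqnorm (\sum_i v (lift ord0 i) * T (lift ord0 i) (lift ord0 j)))); last first.
  by move=> j _; rewrite liftK big_ord_recl Ttrig // mulr0 add0r.
rewrite [X in _ <= s * (_ + X)](eq_bigr (fun j => h j *
  sqnorm (v (lift ord0 j)))); last by move=> j _; rewrite liftK.
have := hP (fun i => v (lift ord0 i)); have := MP (fun i => v (lift ord0 i)).
have := KP (v ord0) (\sum_i v (lift ord0 i) * T (lift ord0 i) ord0).
have := sqnorm_ge0 (v ord0).
have : 0 <= \sum_i sqnorm (v (lift ord0 i)).
  by apply: sumr_ge0 => i _; apply: sqnorm_ge0.
have m1 : Num.min (k * d) (e / 2) <= k * d by rewrite ge_min lexx.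
have m2 : Num.min (k * d) (e / 2) <= e / 2 by rewrite ge_min lexx orbT.
move: (Num.min _ _) m1 m2 => m m1 m2 /=.
move: (sqnorm (v ord0)) (sqnorm (_ + _)) (sqnorm (\sum_i _)) => x y z.
set N := \sum_i sqnorm (v (lift ord0 i)).
set H := \sum_i h i * sqnorm (v _); set S := \sum_i h i * _.
move=> N0 x0 yle zle Hle.
have : k * y <= k * ((s - d) * x + K * z) by rewrite ler_pM2l.
have : k * K * z <= k * K * (M * N) by rewrite ler_wpM2l // mulr_ge0 // ltW.
have : k * K * M * N <= e / 2 * N by rewrite ler_wpM2r.
have : m * x <= k * d * x by rewrite ler_wpM2r.
have : m * N <= e / 2 * N by rewrite ler_wpM2r.
nra.
Qed.

End SquaredModulus.

(** * Positive definite forms *)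

Section QuadraticForms.
Context {R : realType}.

Definition qform n (X : 'M[R]_n) (v : 'cV[R]_n) : R := (v^T *m X *m v) 0 0.

Lemma posdef_unitmx n (X : 'M[R]_n) : posdef X -> X \in unitmx.
Proof.
case=> _ Xpos; rewrite -unitmx_tr -row_free_unit -kermx_eq0.
apply/rowV0P => u /sub_kermxP uX; apply/eqP; apply: contraT => u0.
have := Xpos u^T; rewrite trmx_eq0 trmxK => /(_ u0).
by rewrite -mulmxA -{1}[X]trmxK -trmx_mul uX trmx0 mulmx0 mxE ltxx.
Qed.

Lemma posdef_invmx n (X : 'M[R]_n) : posdef X -> posdef (invmx X).
Proof.
move=> Xpd; have Xu := posdef_unitmx Xpd; case: Xpd => Xsym Xpos.
have Xisym : (invmx X)^T = invmx X by rewrite trmx_inv Xsym.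
split=> // v v0; have := Xpos (invmx X *m v).
rewrite trmx_mul Xisym !mulmxA mulmxKV //; apply.
by apply: contra v0 => /eqP Xv; rewrite -(mulKVmx Xu v) Xv mulmx0.
Qed.

Lemma block_qform n (P M : 'M[R]_n) (r : R) (u w : 'cV[R]_n) :
  P^T = P ->
  qform (block_mx (r *: P) (- (M *m P)) (- (P *m M^T)) (r *: P)) (col_mx u w)
  = r * qform P u + r * qform P w - 2 * ((M^T *m u)^T *m P *m w) 0 0.
Proof.
move=> Psym; rewrite /qform tr_col_mx mul_row_block mul_row_col !mulmxDl.
rewrite !mulmxN !mulNmx -!scalemxAr -!scalemxAl trmx_mul trmxK !mulmxA.
set X := u^T *m M *m P *m w.
have -> : w^T *m P *m M^T *m u = X^T.
  by rewrite /X !trmx_mul !trmxK Psym !mulmxA.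
rewrite !mxE; ring.
Qed.

Lemma qform_lin n (P : 'M[R]_n) (a b : R) (x y : 'cV[R]_n) : P^T = P ->
  qform P (a *: x + b *: y)
  = a ^+ 2 * qform P x + b ^+ 2 * qform P y + 2 * a * b * (x^T *m P *m y) 0 0.
Proof.
move=> Psym; rewrite /qform [(_ + _)^T]linearD /= ![(_ *: _)^T]linearZ /=.
rewrite !mulmxDl !mulmxDr -!scalemxAl -!scalemxAr; set X := x^T *m P *m y.
have -> : y^T *m P *m x = X^T.
  by rewrite /X !trmx_mul trmxK Psym mulmxA.
rewrite !mxE; ring.
Qed.

(** Schur complement of the lower diagonal block: [r] times the form at
    [(u, w)] is [(r^2 P - M P M^T)[u] + P[r w - M^T u]], and [w := M^T u / r]
    makes the last term vanish. *)
Lemma posdef_block n (P M : 'M[R]_n) (r : R) : 0 < r -> posdef P ->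
  posdef (block_mx (r *: P) (- (M *m P)) (- (P *m M^T)) (r *: P)) <->
  forall u : 'cV[R]_n, u != 0 -> qform P (M^T *m u) < r ^+ 2 * qform P u.
Proof.
move=> r0 [Psym Ppos].
have rn : r != 0 by rewrite gt_eqF.
have square u w :
    r * qform (block_mx (r *: P) (- (M *m P)) (- (P *m M^T)) (r *: P))
              (col_mx u w)
    = r ^+ 2 * qform P u - qform P (M^T *m u)
      + qform P (r *: w + (-1) *: (M^T *m u)).
  rewrite block_qform // qform_lin //.
  rewrite (_ : (w^T *m P *m (M^T *m u)) 0 0 = ((M^T *m u)^T *m P *m w) 0 0).
    ring.
  rewrite -[in RHS](trmxK (_ *m w)) [RHS]mxE.
  by rewrite !trmx_mul !trmxK Psym !mulmxA.
split=> [[_ Bpos] u u0|contr].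
  have := square u (r^-1 *: (M^T *m u)).
  rewrite scalerA mulfV // scale1r scaleN1r subrr {4}/qform mulmx0 mxE addr0.
  move=> E; rewrite -subr_gt0 -E pmulr_rgt0 //; apply: Bpos.
  by rewrite col_mx_eq0 negb_and u0.
split.
  by rewrite tr_block_mx !linearZ !linearN /= !trmx_mul trmxK Psym.
move=> v; rewrite -(vsubmxK v); move: (usubmx v) (dsubmx v) => u w.
rewrite col_mx_eq0 negb_and => uw.
rewrite -/(qform _ _) -(pmulr_rgt0 _ r0) square.
have Pge0 x : 0 <= qform P x.
  have [->|/Ppos/ltW //] := eqVneq x 0; by rewrite /qform mulmx0 mxE.
have [u0|u0] := eqVneq u 0.
  move: uw; rewrite u0 eqxx /= => w0.
  rewrite mulmx0 scaler0 addr0 /qform !mulmx0 mxE mulr0 subr0 add0r.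
  by apply: Ppos; rewrite scaler_eq0 (negPf rn).
by rewrite ltr_pwDl // subr_gt0 contr.
Qed.

End QuadraticForms.

(** * Stein's theorem for real matrices *)

Section Stein.
Context {R : realType}.
Local Open Scope complex_scope.

Local Notation complexify := (map_mx (real_complex R)).
Local Notation Remx := (map_mx (@complex.Re R)).
Local Notation Immx := (map_mx (@complex.Im R)).

Lemma Re_sum I (s : seq I) (F : I -> R[i]) :
  complex.Re (\sum_(i <- s) F i) = \sum_(i <- s) complex.Re (F i).
Proof. by apply: (big_morph (@complex.Re R)) => // -[a b] [c d]. Qed.

Lemma Im_sum I (s : seq I) (F : I -> R[i]) :
  complex.Im (\sum_(i <- s) F i) = \sum_(i <- s) complex.Im (F i).
Proof. by apply: (big_morph (@complex.Im R)) => // -[a b] [c d]. Qed.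

Lemma Remx_mull m n p (A : 'M[R]_(m, n)) (W : 'M[R[i]]_(n, p)) :
  Remx (complexify A *m W) = A *m Remx W.
Proof.
apply/matrixP => i j; rewrite !mxE Re_sum; apply: eq_bigr => k _.
by rewrite !mxE; case: (W k j) => a b /=; rewrite mul0r subr0.
Qed.

Lemma Immx_mull m n p (A : 'M[R]_(m, n)) (W : 'M[R[i]]_(n, p)) :
  Immx (complexify A *m W) = A *m Immx W.
Proof.
apply/matrixP => i j; rewrite !mxE Im_sum; apply: eq_bigr => k _.
by rewrite !mxE; case: (W k j) => a b /=; rewrite mul0r addr0.
Qed.

Lemma Remx_mulr m n p (W : 'M[R[i]]_(m, n)) (A : 'M[R]_(n, p)) :
  Remx (W *m complexify A) = Remx W *m A.
Proof.
apply/matrixP => i j; rewrite !mxE Re_sum; apply: eq_bigr => k _.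
by rewrite !mxE; case: (W i k) => a b /=; rewrite mulr0 subr0.
Qed.

Lemma Immx_mulr m n p (W : 'M[R[i]]_(m, n)) (A : 'M[R]_(n, p)) :
  Immx (W *m complexify A) = Immx W *m A.
Proof.
apply/matrixP => i j; rewrite !mxE Im_sum; apply: eq_bigr => k _.
by rewrite !mxE; case: (W i k) => a b /=; rewrite mulr0 add0r.
Qed.

Lemma triangularisation n (A : 'M[R[i]]_n) : (0 < n)%N ->
  exists W T : 'M[R[i]]_n,
    [/\ W \in unitmx, A *m W = W *m T, is_trig_mx T &
        forall j, eigenvalue A (T j j)].
Proof.
move=> n0; have [U Uun Utrig] := Schur A n0.
have Uu := unitarymx_unit Uun.
exists (invmx U), (conjmx U A); split => //.
- by rewrite unitmx_inv.
- by rewrite conjumx // !mulmxA mulVmx // mul1mx.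
- move=> j; have : eigenvalue (conjmx U A) (conjmx U A j j).
    rewrite eigenvalue_root_char char_poly_trig // /root horner_prod.
    by apply/prodf_eq0; exists j; rewrite // hornerXsubC subrr.
  by apply: eigenvalue_conjmx; rewrite ?stablemx_unit ?row_free_unit.
Qed.

(** The real part of the Hermitian matrix [W (diag h) W^*]. *)
Definition realform n (W : 'M[R[i]]_n) (h : 'rV[R]_n) : 'M[R]_n :=
  Remx W *m diag_mx h *m (Remx W)^T + Immx W *m diag_mx h *m (Immx W)^T.

Lemma diag_form n (h u : 'rV[R]_n) :
  (u *m diag_mx h *m u^T) 0 0 = \sum_j h 0 j * u 0 j ^+ 2.
Proof.
by rewrite mxE; apply: eq_bigr => j _; rewrite mul_mx_diag !mxE; ring.
Qed.

Lemma qform_realform n (W : 'M[R[i]]_n) (h : 'rV[R]_n) (v : 'cV[R]_n) :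
  qform (realform W h) v
  = \sum_j h 0 j * sqnorm ((complexify v^T *m W) 0 j).
Proof.
have tr (X : 'M[R]_n) : v^T *m (X *m diag_mx h *m X^T) *m v
    = (v^T *m X) *m diag_mx h *m (v^T *m X)^T.
  by rewrite trmx_mul trmxK !mulmxA.
rewrite /qform mulmxDr mulmxDl mxE !tr !diag_form -big_split /=.
apply: eq_bigr => j _; rewrite -mulrDr /sqnorm.
by rewrite -Remx_mull -Immx_mull ![(map_mx _ _) 0 j]mxE.
Qed.

Lemma realform_sym n (W : 'M[R[i]]_n) (h : 'rV[R]_n) :
  (realform W h)^T = realform W h.
Proof.
by rewrite /realform linearD /= !trmx_mul !trmxK !tr_diag_mx !mulmxA.
Qed.

(** With [B W = W T], the map [v |-> v W] carries [B] to the triangular [T], so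
    the weights for [T] give a solution for [B]; its form is positive because
    [W] is invertible. *)
Lemma stein_of_spectrum n (B : 'M[R]_n) (s : R) : (0 < n)%N ->
  (forall z, eigenvalue (complexify B) z -> sqnorm z < s) ->
  exists2 P : 'M[R]_n, posdef P &
    forall v, v != 0 -> qform P (B^T *m v) < s * qform P v.
Proof.
move=> n0 Bspec.
have [W [T [Wu BW Ttrig Tdiag]]] := triangularisation (complexify B) n0.
have [||h [e [e0 h0 hP]]] := @triangular_weights R s n T.
- exact/is_trig_mxP.
- by move=> i; apply: Bspec.
have qE v : qform (realform W (\row_j h j)) v =
    \sum_j h j * sqnorm ((complexify v^T *m W) 0 j).
  by rewrite qform_realform; apply: eq_bigr => j _; rewrite mxE.
have norm_pos (v : 'cV[R]_n) (c : 'I_n -> R) : v != 0 -> (forall j, 0 < c j) ->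
    0 < \sum_j c j * sqnorm ((complexify v^T *m W) 0 j).
  move=> v0 c0; have cn j : 0 <= c j * sqnorm ((complexify v^T *m W) 0 j).
    by rewrite mulr_ge0 ?sqnorm_ge0 // ltW.
  rewrite lt_neqAle sumr_ge0 // andbT eq_sym; apply: contra v0.
  rewrite psumr_eq0 // => /allP sum0.
  have vW0 : complexify v^T *m W = 0.
    apply/rowP => j; rewrite [RHS]mxE; apply: sqnorm_eq0; apply/eqP.
    by have := sum0 j (mem_index_enum j); rewrite mulf_eq0 gt_eqF.
  have : complexify v^T = 0 by rewrite -(mulmxK Wu (complexify v^T)) vW0 mul0mx.
  by move/eqP; rewrite map_mx_eq0 trmx_eq0.
exists (realform W (\row_j h j)).
  split=> [|v v0]; first exact: realform_sym.
  by rewrite -/(qform _ v) qE norm_pos.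
move=> v v0; rewrite !qE.
have TE j : (complexify (B^T *m v)^T *m W) 0 j
    = \sum_i (complexify v^T *m W) 0 i * T i j.
  by rewrite trmx_mul trmxK map_mxM -mulmxA BW mulmxA mxE.
under eq_bigr => j _ do rewrite TE.
apply: lt_le_trans (hP _); rewrite ltrDl mulr_gt0 //.
have := norm_pos v (fun=> 1) v0 (fun=> ltr01).
by under eq_bigr => j _ do rewrite mul1r.
Qed.

(** The real and imaginary parts of a left eigenvector span a [B^T]-invariant
    space, where [B^T] acts on the pair like multiplication by the eigenvalue;
    the cross terms of the form cancel in the sum over the two parts.  One part may
    vanish, so the strict inequality is used for a nonzero part only. *)
Lemma spectrum_of_stein n (B P : 'M[R]_n) (s : R) : posdef P ->
  (forall v, v != 0 -> qform P (B^T *m v) < s * qform P v) ->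
  forall z, eigenvalue (complexify B) z -> sqnorm z < s.
Proof.
move=> [Psym Ppos] stein z /eigenvalueP[w Bw w0].
set x := (Remx w)^T; set y := (Immx w)^T.
have Bx : B^T *m x = complex.Re z *: x + (- complex.Im z) *: y.
  rewrite /x -trmx_mul -Remx_mulr Bw; apply/matrixP => i j; rewrite !mxE.
  by case: (z) (w _ _) => a b [c d] /=; rewrite mulNr.
have By : B^T *m y = complex.Im z *: x + complex.Re z *: y.
  rewrite /y -trmx_mul -Immx_mulr Bw; apply/matrixP => i j; rewrite !mxE.
  by case: (z) (w _ _) => a b [c d] /=; rewrite addrC.
have qsum : qform P (B^T *m x) + qform P (B^T *m y)
    = sqnorm z * (qform P x + qform P y).
  by rewrite Bx By !qform_lin // /sqnorm; ring.
have q0 : qform P 0 = 0 by rewrite /qform mulmx0 mxE.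
have Pge0 v : 0 <= qform P v.
  by have [->|/Ppos/ltW //] := eqVneq v 0; rewrite q0.
have steinW v : qform P (B^T *m v) <= s * qform P v.
  by have [->|/stein/ltW //] := eqVneq v 0; rewrite mulmx0 q0 mulr0.
have xy0 : (x != 0) || (y != 0).
  apply: contraR w0; rewrite negb_or !negbK !trmx_eq0.
  move=> /andP[/eqP/rowP re0 /eqP/rowP im0]; apply/eqP/rowP => j.
  move: (re0 j) (im0 j); rewrite !mxE.
  by case: (w 0 j) => a b /= -> ->.
have qxy : 0 < qform P x + qform P y.
  by case/orP: xy0 => /Ppos pos; [rewrite ltr_pwDl | rewrite ltr_wpDl].
rewrite -(ltr_pM2r qxy) -qsum mulrDr.
by case/orP: xy0 => /stein pos; [rewrite ltr_leD | rewrite ler_ltD].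
Qed.

Lemma eigenvalue_shift n (A : 'M[R]_n) (q : R) (z : R[i]) :
  eigenvalue (complexify (A + q%:M)) z
  = eigenvalue (complexify A) (z - q%:C).
Proof.
rewrite map_mxD map_scalar_mx /=.
by apply/eigenvalueP/eigenvalueP => -[w E w0]; exists w => //;
  move: E; rewrite mulmxDr mul_mx_scalar scalerBl => E;
  apply/eqP; rewrite -subr_eq0; move/eqP: E; rewrite -subr_eq0 => /eqP <-;
  apply/eqP; rewrite ?opprB ?opprD ?addrA // addrAC.
Qed.

Lemma disk_stable_sqnorm n (A : 'M[R]_n) (q r : R) : 0 < r ->
  Omega_stable (Omega_disk (- q) r) A <->
  forall z, eigenvalue (complexify (A + q%:M)) z -> sqnorm z < r ^+ 2.
Proof.
move=> r0; split=> Astab z.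
  rewrite eigenvalue_shift => /Astab; rewrite /Omega_disk /=.
  by rewrite rmorphN opprK subrK normc_lt.
move=> Az; rewrite /Omega_disk /= normc_lt //; apply: Astab.
by rewrite eigenvalue_shift rmorphN opprK addrK.
Qed.

End Stein.

Theorem theorem3 (R : realType) (n : nat) (hn : (0 < n)%N)
    (A : 'M[R]_n) (q r : R) (hr : 0 < r) :
  Omega_stable (Omega_disk (- q) r) A <->
  exists J S Q : 'M[R]_n,
    [/\ A = (J - S) *m Q,
        J^T = - J,
        S^T = S,
        posdef Q
      & pd_gt
          (block_mx (r *: invmx Q) (- q *: invmx Q)
                    (- q *: invmx Q) (r *: invmx Q))
          (block_mx 0 (J - S) (J - S)^T 0)].
Proof.
have blockE (P M : 'M[R]_n) : P^T = P -> M = A *m P ->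
    block_mx (r *: P) (- q *: P) (- q *: P) (r *: P) - block_mx 0 M M^T 0
    = block_mx (r *: P) (- ((A + q%:M) *m P)) (- (P *m (A + q%:M)^T)) (r *: P).
  move=> Psym ->; rewrite opp_block_mx add_block_mx !oppr0 !addr0.
  rewrite trmx_mul Psym linearD /= tr_scalar_mx mulmxDl mulmxDr.
  by rewrite mul_scalar_mx mul_mx_scalar !opprD !scaleNr ![_ - q *: P]addrC.
rewrite disk_stable_sqnorm //; split=> [Aspec|[J [S [Q [AE _ _ Qpd]]]]].
- have [P Ppd stein] := stein_of_spectrum hn Aspec.
  have Pu := posdef_unitmx Ppd; have Psym := proj1 Ppd.
  pose M := A *m P.
  have JS : 2^-1 *: (M - M^T) - - (2^-1 *: (M + M^T)) = M.
    rewrite opprK -scalerDr addrACA addNr addr0 -mulr2n -scaler_nat scalerA.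
    by rewrite mulVf ?scale1r // pnatr_eq0.
  exists (2^-1 *: (M - M^T)), (- (2^-1 *: (M + M^T))), (invmx P); split.
  + by rewrite JS mulmxK.
  + by rewrite linearZ linearB /= trmxK -scalerN opprB.
  + by rewrite linearN linearZ linearD /= trmxK addrC.
  + exact: posdef_invmx.
  + by rewrite /pd_gt JS invmxK blockE //; apply/posdef_block.
- have Ppd := posdef_invmx Qpd.
  rewrite /pd_gt blockE ?(proj1 Ppd) //; last first.
    by rewrite AE mulmxK // posdef_unitmx.
  by move/(posdef_block _ hr Ppd) => stein; apply: spectrum_of_stein stein.
Qed.
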